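(* For every real number $\lambda\ge 1$, there are no non-zero $\lambda$-injective Banach $f$-algebras.
   Context: All spaces are real. A vector lattice algebra is a real associative algebra that is also a vector lattice in which the product of positive elements is positive. An $f$-algebra is a vector lattice algebra such that $a\wedge b=0$ and $c\ge 0$ imply $(ac)\wedge b=0=(ca)\wedge b$. A Banach $f$-algebra is an $f$-algebra equipped with a complete, submultiplicative lattice norm (lattice norm: $|x|\le |y|$ implies $\|x\|\le\|y\|$). A sublattice-algebra is a linear subspace closed under the lattice operations and the product. A lattice-algebra homomorphism is a linear map preserving the lattice operations and the product. Let $\lambda\ge 1$. A Banach $f$-algebra $I$ is $\lambda$-injective if, for every Banach $f$-algebra $A$, every closed sublattice-algebra $B$ of $A$, and every lattice-algebra homomorphism $T\colon B\to I$, there exists an extension $\tilde T\colon A\to I$ of $T$ that is also a lattice-algebra homomorphism and satisfies $\|\tilde T\|\le\lambda\|T\|$. *)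

(* Defs.v *)
From HB Require Import structures.
From mathcomp Require Import all_boot all_order all_algebra.
From mathcomp Require Import all_classical all_reals all_analysis.

Set Implicit Arguments.
Unset Strict Implicit.
Unset Printing Implicit Defensive.

Import Order.TTheory GRing.Theory Num.Theory.
Import numFieldNormedType.Exports.

Local Open Scope classical_set_scope.
Local Open Scope ring_scope.

(* The lattice order is carried by operations separate from those of Order:
   joining Order.Lattice with GRing.Lmodule or NormedModule is rejected by
   Hierarchy Builder, as Num.RealDomain already inherits both an order and an
   additive structure. *)
HB.mixin Record Lmodule_isVectorLattice (R : realType) V
    of GRing.Lmodule R V := {
  lev : rel V;
  meetv : V -> V -> V;
  joinv : V -> V -> V;
  lev_refl : reflexive lev;
  lev_anti : antisymmetric lev;
  lev_trans : transitive lev;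
  lev_meetv : forall x y z : V, lev x (meetv y z) = lev x y && lev x z;
  joinv_lev : forall x y z : V, lev (joinv x y) z = lev x z && lev y z;
  lev_wD2r : forall z x y : V, lev x y -> lev (x + z) (y + z);
  scalev_ge0 : forall (a : R) (x : V), 0 <= a -> lev 0 x -> lev 0 (a *: x)
}.

#[short(type="vectorLatticeType")]
HB.structure Definition VectorLattice (R : realType) :=
  {V of GRing.Lmodule R V & Lmodule_isVectorLattice R V}.

Definition absv (R : realType) (V : vectorLatticeType R) (x : V) : V :=
  joinv x (- x).

(* The library's algebras are unital, whereas the product of a vector lattice
   algebra need not have an identity. *)
HB.mixin Record VectorLattice_isAlgebra (R : realType) A
    of VectorLattice R A := {
  mulv : A -> A -> A;
  mulvA : forall x y z, mulv x (mulv y z) = mulv (mulv x y) z;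
  mulv_linearl : forall (a : R) x y z,
    mulv (a *: x + y) z = a *: mulv x z + mulv y z;
  mulv_linearr : forall (a : R) x y z,
    mulv z (a *: x + y) = a *: mulv z x + mulv z y;
  mulv_ge0 : forall x y, lev 0 x -> lev 0 y -> lev 0 (mulv x y)
}.

#[short(type="vectorLatticeAlgType")]
HB.structure Definition VectorLatticeAlgebra (R : realType) :=
  {A of VectorLattice R A & VectorLattice_isAlgebra R A}.

HB.mixin Record VectorLatticeAlgebra_isFAlgebra (R : realType) A
    of VectorLatticeAlgebra R A := {
  falg_disjoint : forall a b c : A, meetv a b = 0 -> lev 0 c ->
    meetv (mulv a c) b = 0 /\ meetv (mulv c a) b = 0
}.

#[short(type="fAlgType")]
HB.structure Definition FAlgebra (R : realType) :=
  {A of VectorLatticeAlgebra R A & VectorLatticeAlgebra_isFAlgebra R A}.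

HB.mixin Record FAlgebra_isBanach (R : realType) A
    of FAlgebra R A & CompleteNormedModule R A := {
  ler_normv : forall x y : A, lev (absv x) (absv y) -> `|x| <= `|y|;
  normv_submul : forall x y : A, `|mulv x y| <= `|x| * `|y|
}.

#[short(type="banachFAlgType")]
HB.structure Definition BanachFAlgebra (R : realType) :=
  {A of FAlgebra R A & CompleteNormedModule R A & FAlgebra_isBanach R A}.

Definition sublattice_algebra (R : realType) (A : vectorLatticeAlgType R)
    (B : set A) : Prop :=
  [/\ B 0,
      forall (a : R) x y, B x -> B y -> B (a *: x + y),
      forall x y, B x -> B y -> B (meetv x y),
      forall x y, B x -> B y -> B (joinv x y) &
      forall x y, B x -> B y -> B (mulv x y)].

(* A map on a sublattice-algebra B of A is encoded by a total function on A,
   whose values outside B are irrelevant. *)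
Definition lattice_algebra_hom_on (R : realType) (A C : vectorLatticeAlgType R)
    (B : set A) (T : A -> C) : Prop :=
  [/\ forall (a : R) x y, B x -> B y -> T (a *: x + y) = a *: T x + T y,
      forall x y, B x -> B y -> T (meetv x y) = meetv (T x) (T y),
      forall x y, B x -> B y -> T (joinv x y) = joinv (T x) (T y) &
      forall x y, B x -> B y -> T (mulv x y) = mulv (T x) (T y)].

Definition opnorm_on (R : realType) (A C : normedModType R)
    (B : set A) (T : A -> C) : \bar R :=
  ereal_sup [set `|T x|%:E | x in [set x | B x /\ `|x| <= 1]].

Definition lambda_injective (R : realType) (lambda : R)
    (I : banachFAlgType R) : Prop :=
  forall (A : banachFAlgType R) (B : set A) (T : A -> I),
    sublattice_algebra B -> closed B -> lattice_algebra_hom_on B T ->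
    exists T' : A -> I,
      [/\ forall x, B x -> T' x = T x,
          lattice_algebra_hom_on setT T' &
          (opnorm_on setT T' <= lambda%:E * opnorm_on B T)%E].

(* Main.v *)
Require Import Defs.
From HB Require Import structures.
From mathcomp Require Import all_boot all_order all_algebra.
From mathcomp Require Import all_classical all_reals all_analysis.

Set Implicit Arguments.
Unset Strict Implicit.
Unset Printing Implicit Defensive.

Import Order.TTheory GRing.Theory Num.Theory.
Import numFieldNormedType.Exports.

Local Open Scope classical_set_scope.
Local Open Scope ring_scope.

(** Why no nonzero [I] is injective.  Take a finite set [J] with more than
    [lambda] elements and let [A] be the l^1-sum of [#|J|] copies of [I].  The
    constant families form a copy of [I] inside [A] on which the norm is
    [#|J|] times that of [I], so the identification of the diagonal with [I] is
    a homomorphism of norm at most [1 / #|J|].  A [lambda]-extension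
    [T : A -> I] of it is therefore a strict contraction, whereas each copy of
    [I] sits in [A] isometrically.

    For [x >= 0], the element [x] is the sum over [j] of the elements
    [y_j = T (x at j, 0 elsewhere)], because [T] extends the diagonal
    identification.  The lattice structure alone forces the map
    [P_j : u |-> T (u at j, 0 elsewhere)] to be idempotent on positive
    elements ([component_idem]), like a band projection: in [A] the family
    carried by [j] is disjoint from the rest of the diagonal, so
    [y_j = P_j x] is disjoint from [x - y_j], while [P_j (x - y_j)] lies
    below both.  Idempotency together with [P_j] being a strict contraction
    gives [y_j = 0] for every [j], hence [x = 0]
    ([contractive_extension_trivial]). *)

(** * Vector lattices *)

Section vector_lattice.
Variables (R : realType) (V : vectorLatticeType R).
Implicit Types x y z : V.

Lemma meetv_levl x y : lev (meetv x y) x.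
Proof. by have := lev_refl (meetv x y); rewrite lev_meetv => /andP[]. Qed.

Lemma meetv_levr x y : lev (meetv x y) y.
Proof. by have := lev_refl (meetv x y); rewrite lev_meetv => /andP[]. Qed.

Lemma lev_joinvl x y : lev x (joinv x y).
Proof. by have := lev_refl (joinv x y); rewrite joinv_lev => /andP[]. Qed.

Lemma lev_joinvr x y : lev y (joinv x y).
Proof. by have := lev_refl (joinv x y); rewrite joinv_lev => /andP[]. Qed.

Lemma meetv_idPl x y : lev x y <-> meetv x y = x.
Proof.
split=> [xy|<-]; last exact: meetv_levr.
by apply: lev_anti; rewrite meetv_levl lev_meetv lev_refl.
Qed.

Lemma subv_ge0 x y : lev 0 (y - x) <-> lev x y.
Proof.
split=> [|xy]; first by move=> /(lev_wD2r x _ _); rewrite add0r subrK.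
by have := lev_wD2r (- x) _ _ xy; rewrite subrr.
Qed.

(** Both [x] and [- x] lie below [absv x], so twice [absv x] is positive. *)
Lemma absv_ge0 x : lev 0 (absv x).
Proof.
have absDabs : lev 0 (absv x + absv x).
  apply: (@lev_trans R V (absv x - x)).
    by apply/subv_ge0; exact: lev_joinvl.
  rewrite addrC [in X in lev _ X]addrC.
  exact/lev_wD2r/lev_joinvr.
have half : (2^-1 : R) + 2^-1 = 1 by rewrite [RHS]splitr mul1r.
rewrite -[absv x]scale1r -half scalerDl -scalerDr.
by apply: scalev_ge0; rewrite ?invr_ge0.
Qed.

End vector_lattice.

Lemma absv_eq0 (R : realType) (V : banachFAlgType R) (x : V) :
  absv x = 0 -> x = 0.
Proof.
move=> x0; apply/eqP; rewrite -normr_le0 -[leRHS](@normr0 _ V) -x0.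
exact/ler_normv/lev_joinvl.
Qed.

(** * Finite l^1-sums of a Banach f-algebra *)

(** The sum norm, unlike the maximum norm, makes the diagonal [#|J|] times
    longer than the coordinate copies of [I]; that gap is what beats [lambda].
    A separate name for the type of finite functions keeps its instances apart
    from those of [{ffun J -> I}]. *)
Definition l1sum (R : realType) (J : finType) (I : banachFAlgType R) : Type :=
  {ffun J -> I}.

Section l1sum_instance.
Variables (R : realType) (J : finType) (I : banachFAlgType R).
Notation A := (l1sum J I).
Implicit Types f g h : A.

HB.instance Definition _ := GRing.Lmodule.on A.

Let norm f : R := \sum_j `|f j|.

Fact l1sum_normD f g : norm (f + g) <= norm f + norm g.
Proof.
by rewrite /norm -big_split ler_sum// => j _; rewrite ffunE ler_normD.
Qed.

Fact l1sum_normZ (a : R) f : norm (a *: f) = `|a| * norm f.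
Proof.
by rewrite /norm mulr_sumr; apply: eq_bigr => j _; rewrite ffunE normrZ.
Qed.

Fact l1sum_norm0_eq0 f : norm f = 0 -> f = 0.
Proof.
move=> /eqP; rewrite psumr_eq0// => /allP f0; apply/ffunP => j.
rewrite ffunE; apply/eqP; rewrite -normr_eq0; apply: f0.
by rewrite mem_index_enum.
Qed.

HB.instance Definition _ := Lmodule_isNormed.Build R A
  l1sum_normD l1sum_normZ l1sum_norm0_eq0.

Lemma l1sum_normE f : `|f| = \sum_j `|f j|. Proof. by []. Qed.

Lemma l1sum_norm_coord f j : `|f j| <= `|f|.
Proof. by rewrite l1sum_normE (bigD1 j)//= lerDl sumr_ge0. Qed.

(** A Cauchy filter is Cauchy in each coordinate, and since [J] is finite the
    coordinatewise limits are approached uniformly. *)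
Fact l1sum_complete (F : set_system A) :
  ProperFilter F -> cauchy F -> cvg F.
Proof.
move=> FF /cauchy_ballP Fc.
have cvgF j : cvg ((fun f : A => f j) @ F).
  apply: cauchy_cvg; apply/cauchy_ballP => e e0.
  rewrite near_map2.
  apply: filterS (Fc e e0) => -[f g] /=; rewrite -!ball_normE /=.
  apply: le_lt_trans; have := l1sum_norm_coord (f - g) j.
  by rewrite !ffunE.
apply/cvg_ex; exists [ffun j => lim ((fun f : A => f j) @ F)].
apply/(cvgrPdist_lt (FF := FF)) => e e0.
(* The successor keeps the denominator nonzero and the final bound strict. *)
have d0 : 0 < e / #|J|.+1%:R by rewrite divr_gt0.
have : \forall f \near F, forall j : J,
    `|lim ((fun f : A => f j) @ F) - (f : A) j| < e / #|J|.+1%:R.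
  by apply: filter_forall => j; have /cvgrPdist_lt := cvgF j; exact.
apply: filterS => f fF; rewrite l1sum_normE.
apply: (@le_lt_trans _ _ (\sum_(j : J) e / #|J|.+1%:R)).
  by apply: ler_sum => j _; rewrite !ffunE; exact/ltW/fF.
rewrite sumr_const -[X in X < _]mulr_natr mulrAC ltr_pdivrMr// ltr_pM2l//.
by rewrite ltr_nat.
Qed.

Lemma l1sum_coord_continuous j : continuous (fun f : A => f j : I).
Proof.
move=> f; apply/(cvgrPdist_lt (FF := nbhs_filter f)) => e e0.
apply/nbhs_ballP; exists e => // g; rewrite -ball_normE /=.
apply: le_lt_trans.
by have := l1sum_norm_coord (f - g) j; rewrite !ffunE.
Qed.

Let lel f g : bool := [forall j, lev (f j) (g j)].
Let meetl f g : A := [ffun j => meetv (f j) (g j)].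
Let joinl f g : A := [ffun j => joinv (f j) (g j)].
Let mull f g : A := [ffun j => mulv (f j) (g j)].

Fact l1sum_le_refl : reflexive lel.
Proof. by move=> f; apply/forallP => j; exact: lev_refl. Qed.

Fact l1sum_le_anti : antisymmetric lel.
Proof.
move=> f g /andP[/forallP fg /forallP gf]; apply/ffunP => j.
by apply: lev_anti; rewrite fg gf.
Qed.

Fact l1sum_le_trans : transitive lel.
Proof.
move=> g f h /forallP fg /forallP gh; apply/forallP => j.
exact: lev_trans (fg j) (gh j).
Qed.

Fact l1sum_le_meet f g h : lel f (meetl g h) = lel f g && lel f h.
Proof.
apply/forallP/andP => [fgh|[/forallP fg /forallP fh] j].
  by split; apply/forallP => j;
    move: (fgh j); rewrite ffunE lev_meetv => /andP[].
by rewrite ffunE lev_meetv fg fh.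
Qed.

Fact l1sum_join_le f g h : lel (joinl f g) h = lel f h && lel g h.
Proof.
apply/forallP/andP => [fgh|[/forallP fh /forallP gh] j].
  by split; apply/forallP => j;
    move: (fgh j); rewrite ffunE joinv_lev => /andP[].
by rewrite ffunE joinv_lev fh gh.
Qed.

Fact l1sum_le_wD2r h f g : lel f g -> lel (f + h) (g + h).
Proof.
by move=> /forallP fg; apply/forallP => j; rewrite !ffunE lev_wD2r.
Qed.

Fact l1sum_scale_ge0 (a : R) f : 0 <= a -> lel 0 f -> lel 0 (a *: f).
Proof.
move=> a0 /forallP f0; apply/forallP => j.
by move: (f0 j); rewrite !ffunE; exact: scalev_ge0.
Qed.

HB.instance Definition _ := Lmodule_isVectorLattice.Build R A
  l1sum_le_refl l1sum_le_anti l1sum_le_trans l1sum_le_meet l1sum_join_le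
  l1sum_le_wD2r l1sum_scale_ge0.

Fact l1sum_mulA f g h : mull f (mull g h) = mull (mull f g) h.
Proof. by apply/ffunP => j; rewrite !ffunE mulvA. Qed.

Fact l1sum_mul_linearl (a : R) f g h :
  mull (a *: f + g) h = a *: mull f h + mull g h.
Proof. by apply/ffunP => j; rewrite !ffunE mulv_linearl. Qed.

Fact l1sum_mul_linearr (a : R) f g h :
  mull h (a *: f + g) = a *: mull h f + mull h g.
Proof. by apply/ffunP => j; rewrite !ffunE mulv_linearr. Qed.

Fact l1sum_mul_ge0 f g : lev 0 f -> lev 0 g -> lev 0 (mull f g).
Proof.
move=> /forallP f0 /forallP g0; apply/forallP => j.
by move: (f0 j) (g0 j); rewrite !ffunE; exact: mulv_ge0.
Qed.

HB.instance Definition _ := VectorLattice_isAlgebra.Build R A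
  l1sum_mulA l1sum_mul_linearl l1sum_mul_linearr l1sum_mul_ge0.

Fact l1sum_disjoint f g h : meetv f g = 0 -> lev 0 h ->
  meetv (mulv f h) g = 0 /\ meetv (mulv h f) g = 0.
Proof.
move=> /ffunP fg /forallP h0.
have fgh j : meetv (mulv (f j) (h j)) (g j) = 0 /\
             meetv (mulv (h j) (f j)) (g j) = 0.
  apply: falg_disjoint; first by have := fg j; rewrite !ffunE.
  by have := h0 j; rewrite ffunE.
by split; apply/ffunP => j; rewrite !ffunE; have [] := fgh j.
Qed.

HB.instance Definition _ :=
  VectorLatticeAlgebra_isFAlgebra.Build R A l1sum_disjoint.

Fact l1sum_ler_norm f g : lev (absv f) (absv g) -> `|f| <= `|g|.
Proof.
move=> /forallP fg; apply: ler_sum => j _; apply: ler_normv.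
by have := fg j; rewrite !ffunE.
Qed.

Fact l1sum_norm_submul f g : `|mulv f g| <= `|f| * `|g|.
Proof.
rewrite !l1sum_normE mulr_suml; apply: ler_sum => j _; rewrite ffunE.
apply: le_trans (normv_submul _ _) _.
by rewrite ler_wpM2l// -l1sum_normE l1sum_norm_coord.
Qed.

HB.instance Definition _ := Uniform_isComplete.Build A l1sum_complete.

HB.instance Definition _ :=
  FAlgebra_isBanach.Build R A l1sum_ler_norm l1sum_norm_submul.

End l1sum_instance.

(** * The diagonal copy *)

Section diagonal.
Variables (R : realType) (J : finType) (I : banachFAlgType R).
Notation A := (l1sum J I).

Definition diagv (x : I) : A := [ffun=> x].

Definition diagonal : set A := range diagv.

Lemma diagvE x j : diagv x j = x. Proof. by rewrite ffunE. Qed.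

Lemma norm_diagv x : `|diagv x| = #|J|%:R * `|x|.
Proof.
rewrite l1sum_normE (eq_bigr (fun=> `|x|)); last by move=> j _; rewrite ffunE.
by rewrite sumr_const mulr_natl.
Qed.

Lemma diagonal_sublattice_algebra : sublattice_algebra diagonal.
Proof.
split.
- by exists 0 => //; apply/ffunP => j; rewrite !ffunE.
- move=> a _ _ [x _ <-] [y _ <-]; exists (a *: x + y) => //.
  by apply/ffunP => j; rewrite !ffunE.
- move=> _ _ [x _ <-] [y _ <-]; exists (meetv x y) => //.
  by apply/ffunP => j; rewrite !ffunE.
- move=> _ _ [x _ <-] [y _ <-]; exists (joinv x y) => //.
  by apply/ffunP => j; rewrite !ffunE.
- move=> _ _ [x _ <-] [y _ <-]; exists (mulv x y) => //.
  by apply/ffunP => j; rewrite !ffunE.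
Qed.

(** The diagonal is cut out by the equations [f j = f j0] between continuous
    functions of [f]. *)
Lemma diagonal_closed (j0 : J) : closed diagonal.
Proof.
have -> : diagonal =
    \bigcap_(j in [set: J]) (fun f : A => f j - f j0 : I) @^-1` [set 0].
  apply/seteqP; split=> [_ [x _ <-] j _ /=|f f0].
    by rewrite !diagvE subrr.
  exists (f j0) => //; apply/ffunP => j; rewrite diagvE.
  by apply/esym/eqP; rewrite -subr_eq0; apply/eqP/f0.
apply: closed_bigI => j _; apply: preimage_closed; last first.
  exact/accessible_closed_set1/hausdorff_accessible/norm_hausdorff.
move=> f _; 
have coord_cont i := @l1sum_coord_continuous R J I i f.
exact: (cvgB (coord_cont j) (coord_cont j0)).
Qed.

Lemma coord_hom (B : set A) (j0 : J) :
  lattice_algebra_hom_on B (fun f : A => f j0 : I).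
Proof. by split=> *; rewrite !ffunE. Qed.

(** Where the gain over [lambda] comes from: a constant family in the unit ball
    has its value in the ball of radius [1 / #|J|]. *)
Lemma opnorm_coord_diagonal (j0 : J) :
  (opnorm_on diagonal (fun f : A => f j0 : I) <= (#|J|%:R^-1)%:E)%E.
Proof.
apply: ge_ereal_sup => _ [_ [[x _ <-]] /= + <-].
rewrite norm_diagv diagvE lee_fin => x1.
have J0 : 0 < #|J|%:R :> R by rewrite ltr0n; apply/card_gt0P; exists j0.
by rewrite -[leRHS]mulr1 ler_pdivlMl.
Qed.

End diagonal.

(** * Homomorphisms defined on the whole algebra *)

Section linear_hom.
Variables (R : realType) (A C : banachFAlgType R) (T : A -> C).
Hypothesis T_hom : lattice_algebra_hom_on setT T.

Lemma homD x y : T (x + y) = T x + T y.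
Proof. by have [/(_ 1 x y I I) + _ _ _] := T_hom; rewrite !scale1r. Qed.

Lemma hom0 : T 0 = 0.
Proof. by apply: (addIr (T 0)); rewrite -homD !add0r. Qed.

Lemma homZ a x : T (a *: x) = a *: T x.
Proof.
by have [/(_ a x 0 I I) + _ _ _] := T_hom; rewrite hom0 !addr0.
Qed.

Lemma homB x y : T (x - y) = T x - T y.
Proof. by rewrite homD -scaleN1r homZ scaleN1r. Qed.

Lemma hom_sum (J : finType) (f : J -> A) : T (\sum_j f j) = \sum_j T (f j).
Proof. exact: (big_morph T homD hom0). Qed.

Lemma hom_meet x y : T (meetv x y) = meetv (T x) (T y).
Proof. by have [_ + _ _] := T_hom; exact. Qed.

Lemma hom_le x y : lev x y -> lev (T x) (T y).
Proof. by move=> /meetv_idPl xy; apply/meetv_idPl; rewrite -hom_meet xy. Qed.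

Lemma hom_norm_le q x :
  (opnorm_on setT T <= q%:E)%E -> `|T x| <= q * `|x|.
Proof.
move=> Tq; have [->|x0] := eqVneq x 0; first by rewrite hom0 !normr0 mulr0.
have nx0 : 0 < `|x| by rewrite normr_gt0.
rewrite -ler_pdivrMr// mulrC -[`|x|^-1]gtr0_norm ?invr_gt0// -normrZ -homZ.
rewrite -lee_fin; apply: le_trans Tq; apply: ereal_sup_ubound.
exists (`|x|^-1 *: x) => //=; split=> //.
by rewrite normrZ gtr0_norm ?invr_gt0// mulVf ?gt_eqF.
Qed.

End linear_hom.

(** * Contractive left inverses of the diagonal embedding *)

Section extension.
Variables (R : realType) (J : finType) (I : banachFAlgType R).
Notation A := (l1sum J I).

Definition single (j : J) (x : I) : A := [ffun i => if i == j then x else 0].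

Lemma norm_single j x : `|single j x| = `|x|.
Proof.
rewrite l1sum_normE (bigD1 j)//= ffunE eqxx big1 ?addr0// => i ij.
by rewrite ffunE (negbTE ij) normr0.
Qed.

Lemma diagv_sum x : diagv J x = \sum_j single j x.
Proof.
apply/ffunP => i; rewrite diagvE sum_ffunE (bigD1 i)//= ffunE eqxx.
rewrite big1 ?addr0//.
by move=> j ji; rewrite ffunE eq_sym (negbTE ji).
Qed.

Variable T : A -> I.
Hypothesis T_hom : lattice_algebra_hom_on setT T.
Hypothesis T_diag : forall x, T (diagv J x) = x.

(** The element [y = T (single j x)] is a component of [x]: it is disjoint from
    [x - y], since [single j x] is disjoint from [diagv J x - single j x].
    As [x - y] lies below [x], the element [T (single j (x - y))] lies below
    [y]; it also lies below [T (diagv J (x - y)) = x - y], so it is zero. *)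
Lemma component_idem j x : lev 0 x ->
  T (single j (T (single j x))) = T (single j x).
Proof.
move=> x0; set y := T (single j x).
have ej_le u : lev 0 u -> lev (single j u) (diagv J u).
  move=> u0; apply/forallP => i; rewrite !ffunE.
  by case: ifP; rewrite ?lev_refl.
have ejB u v : single j (u - v) = single j u - single j v.
  by apply/ffunP => i; rewrite !ffunE; case: ifP; rewrite ?subr0.
have ej_mono u v : lev u v -> lev (single j u) (single j v).
  move=> uv; apply/forallP => i; rewrite !ffunE.
  by case: ifP; rewrite ?lev_refl.
have ej0 : single j 0 = 0 by apply/ffunP => i; rewrite !ffunE if_same.
have y_ge0 : lev 0 y.
  by rewrite -(hom0 T_hom) -ej0; apply/(hom_le T_hom)/ej_mono.
have y_le : lev y x by rewrite -[x]T_diag; apply/(hom_le T_hom)/ej_le.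
have yz : meetv y (x - y) = 0.
  rewrite -[x]T_diag -(homB T_hom) -(hom_meet T_hom) -(hom0 T_hom).
  congr (T _); apply/ffunP => i; rewrite !ffunE; case: ifP => _.
    by rewrite subrr; apply: lev_anti; rewrite meetv_levr lev_meetv x0 lev_refl.
  by rewrite subr0; apply/meetv_idPl.
have z_ge0 : lev 0 (x - y) by apply/subv_ge0.
have z_le : lev (x - y) x.
  by apply/subv_ge0; rewrite subKr.
apply/esym/eqP; rewrite -subr_eq0 -(homB T_hom) -ejB; apply/eqP/lev_anti.
rewrite -{1}yz lev_meetv; apply/andP; split; last first.
  by rewrite -(hom0 T_hom) -ej0; apply/(hom_le T_hom)/ej_mono.
apply/andP; split; first exact/(hom_le T_hom)/ej_mono.
by rewrite -[X in lev _ X]T_diag; apply/(hom_le T_hom)/ej_le.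
Qed.

(** The components of [absv x] are fixed by contractions, hence zero, and they
    add up to [absv x]. *)
Lemma contractive_extension_trivial (q : R) (x : I) : q < 1 ->
  (opnorm_on setT T <= q%:E)%E -> x = 0.
Proof.
move=> q1 Tq; apply: absv_eq0; rewrite -[LHS]T_diag diagv_sum (hom_sum T_hom).
apply: big1 => j _; set y := T _.
have : `|y| <= q * `|y|.
  have y_idem : T (single j y) = y by exact/component_idem/absv_ge0.
  rewrite -{1}y_idem -(norm_single j y).
  exact: (hom_norm_le T_hom).
rewrite -subr_ge0 -[X in _ - X]mul1r -mulrBl => y0.
apply/eqP; rewrite -normr_le0.
by move: y0; rewrite nmulr_rge0// subr_lt0.
Qed.

End extension.

Theorem theorem3p18 (R : realType) (lambda : R) (hlambda : 1 <= lambda) :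
  ~ (exists I : banachFAlgType R,
       (exists x : I, x <> 0) /\ lambda_injective lambda I).
Proof.
move=> [I [[x x0] I_inj]]; apply: x0.
pose n := Num.truncn lambda.
have [T [T_ext T_hom T_norm]] := I_inj _ _ _
  (diagonal_sublattice_algebra 'I_n.+1 I) (diagonal_closed (I := I) ord0)
  (coord_hom _ ord0).
have T_diag y : T (diagv 'I_n.+1 y) = y by rewrite T_ext ?diagvE//; exists y.
apply: (contractive_extension_trivial T_hom T_diag (q := lambda / n.+1%:R)).
  by rewrite ltr_pdivrMr// mul1r truncnS_gt.
apply: le_trans T_norm _; rewrite EFinM -[n.+1 in leRHS]card_ord.
by rewrite lee_pmul2l// ?lte_fin ?(lt_le_trans ltr01)// opnorm_coord_diagonal.
Qed.
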